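(* Let $R$ be a ring whose nilradical $\mathcal{N}(R)$ is a prime ideal. Suppose that $J(R)\ne\mathcal{N}(R)$, where $J(R)$ is the Jacobson radical of $R$. Then $\operatorname{udim} R=1$.
   Context: All rings are commutative and unital. A ring $R$ is unit-additive if whenever $u,v$ are units of $R$, $u+v$ is either a unit of $R$ or a nilpotent element. The saturation of a multiplicative set $W\subseteq R$ is $\widetilde W=\{x\in R\mid \exists y\in R,\ xy\in W\}$. Unit dimension: let $R$ be a ring whose nilradical is a prime ideal. Set $W_0=\{1\}$ and $V_0=\widetilde{W_0}=U(R)$ (the units of $R$). For each $i\ge1$ define inductively $W_i$ to be the set of non-nilpotent (finite) sums of elements of $V_{i-1}$ (this set is multiplicatively closed) and $V_i=\widetilde{W_i}$. Then $\operatorname{udim} R$ is the smallest integer $n\ge0$ such that $W_n^{-1}R$ is unit-additive, and $\operatorname{udim} R=\infty$ if no such $n$ exists. *)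

(* Defs.v *)
From HB Require Import structures.
From mathcomp Require Import all_boot all_algebra.
From mathcomp Require Import boolp.
From mathcomp Require Import ring.

Set Implicit Arguments.
Unset Strict Implicit.
Unset Printing Implicit Defensive.

Import GRing.Theory.
Local Open Scope ring_scope.
Local Open Scope quotient_scope.

(* Subsets of a ring are boolean predicates [{pred R}], as in MathComp's
   [idealr_closed] and [mulrClosed]; by classical logic [`[< _ >]] turns any
   proposition into a boolean, so these are arbitrary subsets.

   A commutative unital ring is a [comPzRingType] (possibly zero) or a
   [comNzRingType] (1 != 0).  The latter is forced by MathComp's ideal
   predicates and loses nothing where the nilradical is assumed to be prime,
   because the nilradical of the zero ring is not a proper ideal. *)

Section Subsets.
Variable A : comPzRingType.

(* [GRing.unit] is available only on rings equipped with an inverse function. *)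
Definition units : {pred A} := [pred x | `[< exists y, x * y = 1 >]].

Definition nilradical : {pred A} := [pred x | `[< exists n, x ^+ n = 0 >]].

Definition unit_additive : Prop :=
  forall u v, u \in units -> v \in units ->
    u + v \in units \/ u + v \in nilradical.

Definition saturation (W : {pred A}) : {pred A} :=
  [pred x | `[< exists y, x * y \in W >]].

Definition finite_sums (V : {pred A}) : {pred A} :=
  [pred x | `[< exists2 s : seq A, {subset s <= V} & x = \sum_(y <- s) y >]].

(* This is W_n; V_n is [saturation (unit_sums n)]. *)
Fixpoint unit_sums (n : nat) : {pred A} :=
  if n is m.+1 then
    [pred x in finite_sums (saturation (unit_sums m)) | x \notin nilradical]
  else pred1 1.

Lemma saturation1 : saturation (pred1 1) =i units.
Proof.
by move=> x; apply/asboolP/asboolP => -[y xy]; exists y; exact/eqP.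
Qed.

End Subsets.
Arguments units A : clear implicits.
Arguments nilradical A : clear implicits.
Arguments unit_additive A : clear implicits.
Arguments unit_sums A n : clear implicits.

Section Ideals.
Variable R : comNzRingType.

(* [idealr_closed P] includes [1 \notin P]. *)
Definition prime_ideal (P : {pred R}) : Prop :=
  idealr_closed P /\ prime_idealr_closed P.

Definition maximal_ideal (M : {pred R}) : Prop :=
  idealr_closed M /\
  forall I : {pred R}, idealr_closed I -> {subset M <= I} -> I =i M.

Definition jacobson_radical : {pred R} :=
  [pred x | `[< forall M : {pred R}, maximal_ideal M -> x \in M >]].

End Ideals.
Arguments jacobson_radical R : clear implicits.

(* The localization W^-1 A of a commutative ring at a multiplicative set: the
   quotient of A * W by (a, s) ~ (b, t) iff u a t = u b s for some u in W. *)
Module Localization.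
Section Localization.
Variables (A : comPzRingType) (W : mulrClosed A).

Definition ratio : Type := (A * {s : A | s \in W})%type.
#[export] HB.instance Definition _ := Choice.on ratio.

Implicit Types x y z : ratio.

Definition num x : A := x.1.
Definition den x : A := val x.2.
Definition mk (a s : A) (sW : s \in W) : ratio := (a, exist _ s sW).

Lemma den_in x : den x \in W. Proof. exact: valP. Qed.

Lemma denM x y : den x * den y \in W.
Proof. by apply: rpredM; apply: den_in. Qed.

Definition equiv x y : bool :=
  `[< exists2 u, u \in W & u * (num x * den y) = u * (num y * den x) >].

Lemma equiv_refl : reflexive equiv.
Proof. by move=> x; apply/asboolP; exists 1 => //; exact: rpred1. Qed.

Lemma equiv_sym : symmetric equiv.
Proof.
by move=> x y; apply/asboolP/asboolP => -[u uW e]; exists u; rewrite // -e.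
Qed.

Lemma equiv_trans : transitive equiv.
Proof.
move=> y x z /asboolP[u uW xy] /asboolP[v vW yz]; apply/asboolP.
exists (u * v * den y); first by rewrite !rpredM ?den_in.
transitivity (u * (num x * den y) * (v * den z)); first by ring.
rewrite xy; transitivity (v * (num y * den z) * (u * den x)); first by ring.
by rewrite yz; ring.
Qed.

Canonical equiv_equivRel := EquivRel equiv equiv_refl equiv_sym equiv_trans.

Definition type := {eq_quot equiv}.

#[export] HB.instance Definition _ : EqQuotient _ equiv type := EqQuotient.on type.
#[export] HB.instance Definition _ := Choice.on type.

Lemma equiv_repr x : equiv x (repr (\pi_type x)).
Proof. by apply/eqmodP; rewrite reprK. Qed.

Lemma eq_pi x y :
  num x * den y = num y * den x -> x = y %[mod type].
Proof.
by move=> e; apply/eqmodP/asboolP; exists 1; rewrite ?e //; exact: rpred1.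
Qed.

Definition add0 x y : ratio :=
  mk (num x * den y + num y * den x) (denM x y).
Definition opp0 x : ratio := mk (- num x) (den_in x).
Definition mul0 x y : ratio := mk (num x * num y) (denM x y).

Lemma numden_mk (a s : A) (sW : s \in W) :
  (num (mk a sW) = a) * (den (mk a sW) = s).
Proof. by []. Qed.

Lemma numden_op x y :
  (num (add0 x y) = num x * den y + num y * den x) *
  (den (add0 x y) = den x * den y) *
  (num (mul0 x y) = num x * num y) * (den (mul0 x y) = den x * den y).
Proof. by []. Qed.

Lemma numden_opp x : (num (opp0 x) = - num x) * (den (opp0 x) = den x).
Proof. by []. Qed.

Definition numdenE := (numden_op, numden_opp, numden_mk).

Definition frac (a s : A) (sW : s \in W) : type := \pi_type (mk a sW).
Definition zero : type := frac 0 (rpred1 W).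
Definition one : type := frac 1 (rpred1 W).
Definition add := lift_op2 type add0.
Definition opp := lift_op1 type opp0.
Definition mul := lift_op2 type mul0.

Lemma pi_add : {morph \pi : x y / add0 x y >-> add x y}.
Proof.
move=> x y; unlock add; apply/eqmodP/asboolP.
have /asboolP[u uW xx] := equiv_repr x; have /asboolP[v vW yy] := equiv_repr y.
move: (repr (\pi_type x)) (repr (\pi_type y)) xx yy => x' y' xx yy.
exists (u * v); first exact: rpredM.
rewrite !numdenE.
transitivity (u * (num x * den x') * (v * den y * den y') +
              v * (num y * den y') * (u * den x * den x')); first by ring.
by rewrite xx yy; ring.
Qed.

Lemma pi_opp : {morph \pi : x / opp0 x >-> opp x}.
Proof.
move=> x; unlock opp; apply/eqmodP/asboolP.
have /asboolP[u uW xx] := equiv_repr x; exists u => //.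
move: (repr (\pi_type x)) xx => x' xx.
by rewrite !numdenE !mulNr !mulrN xx.
Qed.

Lemma pi_mul : {morph \pi : x y / mul0 x y >-> mul x y}.
Proof.
move=> x y; unlock mul; apply/eqmodP/asboolP.
have /asboolP[u uW xx] := equiv_repr x; have /asboolP[v vW yy] := equiv_repr y.
move: (repr (\pi_type x)) (repr (\pi_type y)) xx yy => x' y' xx yy.
exists (u * v); first exact: rpredM.
rewrite !numdenE.
transitivity (u * (num x * den x') * (v * (num y * den y'))); first by ring.
by rewrite xx yy; ring.
Qed.

Lemma addA : associative add.
Proof.
elim/quotW=> x; elim/quotW=> y; elim/quotW=> z; rewrite -!pi_add.
by apply: eq_pi; rewrite !numdenE; ring.
Qed.

Lemma addC : commutative add.
Proof.
elim/quotW=> x; elim/quotW=> y; rewrite -!pi_add.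
by apply: eq_pi; rewrite !numdenE; ring.
Qed.

Lemma add0l : left_id zero add.
Proof.
elim/quotW=> x; rewrite -pi_add.
by apply: eq_pi; rewrite !numdenE; ring.
Qed.

Lemma addNl : left_inverse zero opp add.
Proof.
elim/quotW=> x; rewrite -pi_opp -pi_add.
by apply: eq_pi; rewrite !numdenE; ring.
Qed.

#[export] HB.instance Definition _ := GRing.isZmodule.Build type addA addC add0l addNl.

Lemma mulA : associative mul.
Proof.
elim/quotW=> x; elim/quotW=> y; elim/quotW=> z; rewrite -!pi_mul.
by apply: eq_pi; rewrite !numdenE; ring.
Qed.

Lemma mulC : commutative mul.
Proof.
elim/quotW=> x; elim/quotW=> y; rewrite -!pi_mul.
by apply: eq_pi; rewrite !numdenE; ring.
Qed.

Lemma mul1l : left_id one mul.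
Proof.
elim/quotW=> x; rewrite -pi_mul.
by apply: eq_pi; rewrite !numdenE; ring.
Qed.

Lemma mulDl : left_distributive mul add.
Proof.
elim/quotW=> x; elim/quotW=> y; elim/quotW=> z.
rewrite -!pi_mul -!pi_add -!pi_mul.
by apply: eq_pi; rewrite !numdenE; ring.
Qed.

#[export] HB.instance Definition _ :=
  GRing.Zmodule_isComPzRing.Build type mulA mulC mul1l mulDl.

End Localization.
Module Exports. HB.reexport. End Exports.
End Localization.
Export Localization.Exports.

Notation localization := Localization.type.

Section UnitDimension.
Variable R : comNzRingType.
Hypothesis prime_nil : prime_ideal (nilradical R).

Lemma saturation_mulr_closed (W : {pred R}) :
  mulr_closed W -> mulr_closed (saturation W).
Proof.
case=> W1 WM; split=> [|x y /asboolP[x' xW] /asboolP[y' yW]].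
  by apply/asboolP; exists 1; rewrite mulr1.
by apply/asboolP; exists (x' * y'); rewrite mulrACA WM.
Qed.

Lemma finite_sums_mulr_closed (V : {pred R}) :
  mulr_closed V -> mulr_closed (finite_sums V).
Proof.
case=> V1 VM; split=> [|_ _ /asboolP[s sV ->] /asboolP[t tV ->]].
  apply/asboolP; exists [:: 1]; last by rewrite big_seq1.
  by move=> x; rewrite inE => /eqP->.
apply/asboolP; exists [seq x * y | x <- s, y <- t].
  by move=> _ /allpairsP[[x y] /= [xs yt ->]]; apply: VM; [apply: sV|apply: tV].
by rewrite big_distrlr big_allpairs_dep.
Qed.

Lemma unit_sums_mulr_closed n : mulr_closed (unit_sums R n).
Proof.
have [[_ nil1 _] nilM] := prime_nil.
elim: n => [|n /saturation_mulr_closed/finite_sums_mulr_closed[S1 SM]].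
  by split=> [|x y /eqP-> /eqP->]; rewrite inE ?mulr1.
split=> [|x y /andP[xS xN] /andP[yS yN]]; apply/andP; split=> //.
  exact: SM.
by apply/negP => /nilM; rewrite (negPf xN) (negPf yN).
Qed.

Definition unit_sums_mset n : mulrClosed R :=
  HB.pack (unit_sums R n : R -> bool)
    (GRing.isMulClosed.Build R (unit_sums R n) (unit_sums_mulr_closed n)).

Definition unit_additive_at (n : nat) : bool :=
  `[< unit_additive (localization (unit_sums_mset n)) >].

(* [None] stands for infinity. *)
Definition udim : option nat :=
  if pselect (exists n, unit_additive_at n) is left ex_n
  then Some (ex_minn ex_n) else None.

End UnitDimension.

(* Main.v *)
(** If [j] lies in the Jacobson radical and is not nilpotent, then every multiple
    [r * j = (1 + r * j) + (-1)] is a sum of two units.  For [r = 1] the sum [j]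
    is neither a unit nor nilpotent, so [R], which is its localization at [{1}],
    is not unit-additive.  For [r] not nilpotent, [r * j] is not nilpotent either,
    the nilradical being prime, so [r * j] belongs to [W_1] and [r] becomes
    invertible in [W_1^-1 R].  Hence every element of [W_1^-1 R] is a unit or
    nilpotent. *)
Require Import Defs.
From mathcomp Require Import all_boot all_algebra.
From mathcomp Require Import boolp classical_sets.
From mathcomp Require Import ring.

Set Implicit Arguments.
Unset Strict Implicit.
Unset Printing Implicit Defensive.

Import GRing.Theory.
Local Open Scope ring_scope.

(** * Units and nilpotent elements *)

Section UnitsAndNilpotents.
Variable A : comPzRingType.

Lemma unitsP (x : A) : reflect (exists y, x * y = 1) (x \in units A).
Proof. exact: asboolP. Qed.

Lemma nilradicalP (x : A) : reflect (exists n, x ^+ n = 0) (x \in nilradical A).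
Proof. exact: asboolP. Qed.

Lemma saturationP (W : {pred A}) x :
  reflect (exists y, x * y \in W) (x \in saturation W).
Proof. exact: asboolP. Qed.

(** The finite geometric series in [x] is an inverse: the product telescopes to [1 - x ^+ n]. *)
Lemma units1B_nilpotent (x : A) : x \in nilradical A -> 1 - x \in units A.
Proof.
move=> /nilradicalP[n xn]; apply/unitsP; exists (\sum_(i < n) x ^+ i).
by rewrite -opprB mulNr -subrX1 xn sub0r opprK.
Qed.

End UnitsAndNilpotents.

(** * Maximal ideals and the Jacobson radical *)

Section Ideals.
Variable R : comNzRingType.
Implicit Types (I M : {pred R}) (x r : R).

Lemma idealr_closedMl I r x : idealr_closed I -> x \in I -> r * x \in I.
Proof. by case=> I0 _ IDM xI; rewrite -[_ * _]addr0 IDM. Qed.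

Lemma idealr_closedD I x y :
  idealr_closed I -> x \in I -> y \in I -> x + y \in I.
Proof. by case=> _ _ IDM xI yI; rewrite -[x]mul1r IDM. Qed.

Lemma idealr_closed_nunit I x :
  idealr_closed I -> x \in I -> x \notin units R.
Proof.
move=> Iid xI; apply/negP => /unitsP[y xy]; have [_ /negP + _] := Iid; apply.
by rewrite -xy mulrC idealr_closedMl.
Qed.

Lemma principal_idealr_closed x :
  x \notin units R -> idealr_closed [pred z : R | `[< exists r, z = r * x >]].
Proof.
move=> xNunit; split=> [||a _ _ /asboolP[r ->] /asboolP[s ->]].
- by apply/asboolP; exists 0; rewrite mul0r.
- apply: contra xNunit => /asboolP[r e]; apply/unitsP; exists r.
  by rewrite mulrC.
- by apply/asboolP; exists (a * r + s); ring.
Qed.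

Lemma exists_maximal_ideal I :
  idealr_closed I -> exists2 M, maximal_ideal M & {subset I <= M}.
Proof.
move=> Iid; have [I0 I1 IDM] := Iid.
(* Zorn's lemma is applied to the sets [X] such that [I] together with [X] is a
   proper ideal, so that the union of the empty chain is also covered. *)
pose IU (X : set R) : {pred R} := [pred x | (x \in I) || `[< X x >]].
have [F FP Ftot|X [Xid Xmax]] := @Zorn_bigcup R (fun X => idealr_closed (IU X)).
  have incl (X : set R) x : F X -> x \in IU X ->
      x \in IU (\bigcup_(Y in F) Y)%classic.
    move=> FX /orP[xI|/asboolP Xx]; apply/orP; [by left|right].
    by apply/asboolP; exists X.
  split=> [||a u v]; first by rewrite inE I0.
    apply/negP => /orP[|/asboolP[X FX X1]]; first exact/negP.
    have [_ /negP + _] := FP X FX; apply.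
    by rewrite inE; apply/orP; right; apply/asboolP.
  move=> /orP[uI|/asboolP[X FX Xu]] /orP[vI|/asboolP[Y FY Yv]].
  - by rewrite inE IDM.
  - have [_ _ YDM] := FP Y FY; apply: (incl Y) => //.
    by apply: YDM; rewrite inE ?uI //; apply/orP; right; apply/asboolP.
  - have [_ _ XDM] := FP X FX; apply: (incl X) => //.
    by apply: XDM; rewrite inE ?vI //; apply/orP; right; apply/asboolP.
  (* The summands come from two members of the chain; the larger one contains both. *)
  - have [XY|YX] := Ftot X Y FX FY.
      have [_ _ YDM] := FP Y FY; apply: (incl Y) => //.
      by apply: YDM; rewrite inE; apply/orP; right; apply/asboolP => //; apply: XY.
    have [_ _ XDM] := FP X FX; apply: (incl X) => //.
    by apply: XDM; rewrite inE; apply/orP; right; apply/asboolP => //; apply: YX.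
exists (IU X) => [|x xI]; last by rewrite inE xI.
split=> // K Kid XK x; apply/idP/idP => [xK|]; last exact: XK.
apply: contrapT => xNX.
(* [K] contains [I], so [IU] sends it to itself and it belongs to the Zorn family; by [x] it is
   strictly larger than [X]. *)
have [] := Xmax [set y | y \in K]%classic.
  split=> [y Xy|KX].
    by apply: XK; rewrite inE; apply/orP; right; apply/asboolP.
  by apply: xNX; rewrite inE; apply/orP; right; apply/asboolP/KX.
suff -> : IU [set y | y \in K]%classic = K by [].
apply/funext => y; apply/idP/idP => [/orP[yI|/asboolP//]|yK].
  by apply: XK; rewrite inE yI.
by apply/orP; right; apply/asboolP.
Qed.

Lemma maximal_ideal_comaximal M x :
  maximal_ideal M -> x \notin M -> exists r, 1 - r * x \in M.
Proof.
move=> [Mid Mmax] xM; have [M0 _ MDM] := Mid; apply: contrapT => noinv.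
(* This is the ideal [M + (x)], and [noinv] says that it is proper; maximality then forces [K] to
   equal [M], although [x] is in [K]. *)
pose K : {pred R} := [pred z | `[< exists r, z - r * x \in M >]].
have KM : {subset M <= K}.
  by move=> z zM; apply/asboolP; exists 0; rewrite mul0r subr0.
have Kid : idealr_closed K.
  split=> [||a u v /asboolP[r ur] /asboolP[s vs]]; first exact: KM.
    by apply/negP => /asboolP.
  apply/asboolP; exists (a * r + s).
  have -> : a * u + v - (a * r + s) * x = a * (u - r * x) + (v - s * x) by ring.
  exact: MDM.
move/negP: xM; apply; rewrite -(Mmax K Kid KM).
by apply/asboolP; exists 1; rewrite mul1r subrr.
Qed.

(** If a maximal ideal missed a nilpotent [x], it would contain some [1 - r * x], which is a unit
    because [r * x] is nilpotent. *)
Lemma nilradical_sub_jacobson :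
  {subset nilradical R <= jacobson_radical R}.
Proof.
move=> x /nilradicalP[n xn]; apply/asboolP => M Mmax.
apply: contrapT => /negP /(maximal_ideal_comaximal Mmax)[r].
move=> /(idealr_closed_nunit (proj1 Mmax)) /negP; apply.
by apply/units1B_nilpotent/nilradicalP; exists n; rewrite exprMn xn mulr0.
Qed.

(** Otherwise [1 + r * x] generates a proper ideal, and a maximal ideal above it also contains [x],
    hence 1. *)
Lemma units1D_jacobson r x :
  x \in jacobson_radical R -> 1 + r * x \in units R.
Proof.
move=> /asboolP xJ; apply: contrapT => /negP nu.
have [M Mmax sub] := exists_maximal_ideal (principal_idealr_closed nu).
have [[_ /negP M1 _] _] := Mmax; apply: M1.
have -> : 1 = - r * x + (1 + r * x) :> R by ring.
apply: idealr_closedD (proj1 Mmax) _ _.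
  exact: idealr_closedMl (proj1 Mmax) (xJ M Mmax).
by apply: sub; apply/asboolP; exists 1; rewrite mul1r.
Qed.

Lemma jacobson_nunit x : x \in jacobson_radical R -> x \notin units R.
Proof.
move=> xJ; apply/negP => /unitsP[y xy].
(* With [y] inverse to [x], the unit [1 + (- y) * x] is 0. *)
have /unitsP[z] := units1D_jacobson (- y) xJ.
rewrite mulNr mulrC [y * x]mulrC xy subrr mulr0 => /esym/eqP.
by rewrite oner_eq0.
Qed.

End Ideals.

(** * Units and nilpotents of a localization, read off numerators *)

Section Fractions.
Variables (A : comPzRingType) (W : mulrClosed A).
Import Localization.

Lemma fracP (z : localization W) : exists a s (sW : s \in W), z = frac a sW.
Proof.
by elim/quotW: z => -[a [s sW]]; exists a, s, sW.
Qed.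

Lemma eq_frac (a b s t : A) (sW : s \in W) (tW : t \in W) :
  frac a sW = frac b tW <-> exists2 u, u \in W & u * (a * t) = u * (b * s).
Proof.
split=> [/eqmodP /asboolP //|e].
by apply/eqmodP/asboolP.
Qed.

Lemma frac_mul (a b s t : A) (sW : s \in W) (tW : t \in W) :
  frac a sW * frac b tW = frac (a * b) (rpredM sW tW).
Proof.
by rewrite /frac -[LHS]pi_mul; apply: eq_pi; rewrite !numdenE.
Qed.

Lemma frac_add (a b s t : A) (sW : s \in W) (tW : t \in W) :
  frac a sW + frac b tW = frac (a * t + b * s) (rpredM sW tW).
Proof.
by rewrite /frac -[LHS]pi_add; apply: eq_pi; rewrite !numdenE.
Qed.

Lemma frac_exp (a s : A) (sW : s \in W) n :
  frac a sW ^+ n = frac (a ^+ n) (rpredX n sW).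
Proof.
elim: n => [|n IHn].
  by apply/eq_frac; exists 1; rewrite ?rpred1 ?expr0.
rewrite exprS IHn frac_mul; apply/eq_frac; exists 1; first exact: rpred1.
by rewrite !exprS; ring.
Qed.

(** An inverse [b / t] of [a / s] gives [u * a * b = u * s * t] with [u] in [W], so [b * u]
    multiplies [a] into [W]. Conversely, if [a * b] is in [W], then [(b * s) / (a * b)] is an
    inverse. *)
Lemma frac_units (a s : A) (sW : s \in W) :
  (frac a sW \in units (localization W)) = (a \in saturation W).
Proof.
apply/unitsP/saturationP => [[z]|[b abW]].
  have [b [t [tW ->]]] := fracP z; rewrite frac_mul => /eq_frac[u uW e].
  exists (b * u); have -> : a * (b * u) = u * (a * b * 1) by ring.
  by rewrite e mul1r !rpredM.
exists (frac (b * s) abW); rewrite frac_mul; apply/eq_frac.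
by exists 1; [exact: rpred1|ring].
Qed.

Lemma frac_nilradical (a s : A) (sW : s \in W) :
  frac a sW \in nilradical (localization W) <->
  exists n, exists2 u, u \in W & u * a ^+ n = 0.
Proof.
split=> [/nilradicalP[n]|[n [u uW e]]].
  rewrite frac_exp => /eq_frac[u uW e]; exists n, u => //.
  by move: e; rewrite mulr1 mul0r mulr0.
apply/nilradicalP; exists n; rewrite frac_exp; apply/eq_frac; exists u => //.
by rewrite mulr1 e mul0r mulr0.
Qed.

End Fractions.

(** * Unit-additivity at levels 0 and 1 *)

Section UnitDimension.
Variables (R : comNzRingType) (prime_nil : prime_ideal (nilradical R)).

Lemma unit_additive_at0 : unit_additive_at prime_nil 0 -> unit_additive R.
Proof.
move=> /asboolP; set W := unit_sums_mset _ _ => add u v uU vU.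
have one : 1 \in W by exact: rpred1.
have WU x : (x \in saturation W) = (x \in units R) by exact: saturation1.
have [|||] := add (Localization.frac u one) (Localization.frac v one).
- by rewrite frac_units WU.
- by rewrite frac_units WU.
- by rewrite frac_add frac_units WU !mulr1; left.
(* The factor [w] that kills the power lies in [W_0], so it is 1 and the numerator is itself
   nilpotent. *)
rewrite frac_add => /frac_nilradical[n [w /eqP-> e]]; right.
by apply/nilradicalP; exists n; rewrite -e !mulr1 mul1r.
Qed.

Lemma not_unit_additive_jacobson j :
  j \in jacobson_radical R -> j \notin nilradical R -> ~ unit_additive R.
Proof.
move=> jJ jN add; have [|||] := add (1 + j) (-1).
- by rewrite -[j]mul1r units1D_jacobson.
- by apply/unitsP; exists (-1); ring.
- by rewrite addrAC subrr add0r (negPf (jacobson_nunit jJ)).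
- by rewrite addrAC subrr add0r (negPf jN).
Qed.

Lemma saturation_unit_sums1 j r :
    j \in jacobson_radical R -> j \notin nilradical R ->
  r \notin nilradical R -> r \in saturation (unit_sums R 1).
Proof.
move=> jJ jN rN; apply/saturationP; exists j; apply/andP; split; last first.
  have [_ nilM] := prime_nil.
  by apply/negP => /nilM; rewrite (negPf rN) (negPf jN).
apply/asboolP; exists [:: 1 + r * j; -1].
  (* [V_0] is the set of units, so both summands must be shown to be units. *)
  move=> x xs; apply: etrans (saturation1 x) _; move: x xs.
  apply/allP; rewrite /= units1D_jacobson //= andbT.
  by apply/unitsP; exists (-1); ring.
by rewrite big_cons big_seq1; ring.
Qed.

Lemma unit_additive_at1 j :
    j \in jacobson_radical R -> j \notin nilradical R ->
  unit_additive_at prime_nil 1.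
Proof.
move=> jJ jN; apply/asboolP => u v _ _.
have [a [s [sW ->]]] := fracP (u + v); rewrite frac_units.
have [/nilradicalP[n an]|aN] := boolP (a \in nilradical R); [right|left].
  by apply/frac_nilradical; exists n, 1; [exact: rpred1|rewrite mul1r].
exact: saturation_unit_sums1 jJ jN aN.
Qed.

End UnitDimension.

Theorem proposition7p1 (R : comNzRingType)
    (prime_nil : prime_ideal (nilradical R))
    (jacobson_neq_nil : ~ (jacobson_radical R =i nilradical R)) :
  udim prime_nil = Some 1%N.
Proof.
(* Since the nilradical lies in the Jacobson radical, the two can differ only by such a [j]. *)
have [j jJ jN] : exists2 j, j \in jacobson_radical R & j \notin nilradical R.
  apply: contrapT => noj; apply: jacobson_neq_nil => x.
  apply/idP/idP => [xJ|/nilradical_sub_jacobson//].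
  by apply: contrapT => /negP xN; apply: noj; exists x.
have add1 := unit_additive_at1 prime_nil jJ jN.
rewrite /udim; case: pselect => [ex_n|[]]; last by exists 1%N.
congr Some; case: ex_minnP => n addn n_min.
(* Minimality and [add1] give [n <= 1]; it remains to exclude [n = 0]. *)
apply/anti_leq; rewrite n_min // lt0n; apply/eqP => n0; rewrite n0 in addn.
exact: not_unit_additive_jacobson jJ jN (unit_additive_at0 addn).
Qed.
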